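(* Let $p\ge q\ge1$ be integers, $n=p+q$, and let $\Lambda=(\lambda_1,\dots,\lambda_p,\mu_1,\dots,\mu_q)$ be an admissible $n$-tuple of real numbers, that is, $\lambda_1\le\cdots\le\lambda_p$, $\mu_1\le\cdots\le\mu_q$ and $\lambda_1>\mu_q$. Let $\mathcal O_\Lambda\subset\mathfrak u(p,q)^*$ be the coadjoint $\mathrm U(p,q)$-orbit of $\mathrm{diag}(\lambda_1,\dots,\lambda_p,\mu_1,\dots,\mu_q)$, and let $p_n:\mathfrak u(p,q)^*\to\mathfrak u(p,q-1)^*$ be the projection. If a coadjoint $\mathrm U(p,q-1)$-orbit $\mathcal O$ is contained in the image $p_n(\mathcal O_\Lambda)$, then $\mathcal O$ is admissible. Moreover, if the real eigenvalues of $\mathcal O$ are arranged in non-decreasing order $$\mu^{n-1}_1\le\mu^{n-1}_2\le\cdots\le\mu^{n-1}_{q-1}\le\lambda^{n-1}_1\le\lambda^{n-1}_2\le\cdots\le\lambda^{n-1}_p,$$ then the following interlacing conditions hold: $\mu_i\le\mu_i^{n-1}\le\mu_{i+1}$ for $1\le i\le q-1$; $\lambda_j\le\lambda_j^{n-1}\le\lambda_{j+1}$ for $1\le j\le p-1$; and $\lambda^{n-1}_p\ge\lambda_p$.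
   Context: Let $J=\mathrm{diag}(1,\dots,1,-1,\dots,-1)$ with $p$ entries $1$ followed by $q$ entries $-1$; $\mathrm U(p,q)$ is the group preserving the Hermitian form defined by $J$. Using the form $\mathrm{Tr}(AB)$, the dual space $\mathfrak u(p,q)^*$ is identified with $\sqrt{-1}\cdot\mathfrak u(p,q)$, i.e. with the space of complex $n\times n$ matrices $A$ such that $JA$ is Hermitian; the coadjoint action becomes conjugation. The same conventions apply to $\mathfrak u(p,q-1)^*$, with $J$ replaced by its upper left $(n-1)\times(n-1)$ block. The subalgebra $\mathfrak g_{n-1}\cong\mathfrak u(p,q-1)$ of $\mathfrak u(p,q)$ corresponds to the upper left principal $(n-1)\times(n-1)$ submatrix, and under the identifications $p_n$ sends a matrix $A$ to its upper left principal $(n-1)\times(n-1)$ submatrix. The image $p_n(\mathcal O_\Lambda)$ is a union of coadjoint $\mathrm U(p,q-1)$-orbits. A coadjoint orbit of $\mathrm U(p,q-1)$ is called admissible if it is the orbit of a real diagonal matrix $\mathrm{diag}(\lambda'_1,\dots,\lambda'_p,\mu'_1,\dots,\mu'_{q-1})$ with $\lambda'_1\le\cdots\le\lambda'_p$, $\mu'_1\le\cdots\le\mu'_{q-1}$ and $\lambda'_1>\mu'_{q-1}$ (the last condition being vacuous if $q=1$). The eigenvalues of an orbit are the eigenvalues of any matrix in it. *)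

(* Defs.v *)
From HB Require Import structures.
From mathcomp Require Import all_boot all_order all_algebra.
From mathcomp Require Import sesquilinear spectral.
From mathcomp Require Import boolp classical_sets reals.
From mathcomp Require Import complex.

Set Implicit Arguments.
Unset Strict Implicit.
Unset Printing Implicit Defensive.

Import Order.TTheory GRing.Theory Num.Theory.

Local Open Scope classical_set_scope.
Local Open Scope complex_scope.
Local Open Scope sesquilinear_scope.
Local Open Scope ring_scope.

Section IndefiniteUnitary.
Variable R : realType.

Definition signature_mx (p q : nat) : 'M[R[i]]_(p + q) :=
  diag_mx (row_mx (const_mx 1) (const_mx (-1))).

(* [M ^t*] is the conjugate transpose; vectors are columns. *)
Definition indefinite_unitary (p q : nat) : set 'M[R[i]]_(p + q) :=
  [set g | g ^t* *m signature_mx p q *m g = signature_mx p q].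
Arguments indefinite_unitary : clear implicits.

(* The dual u(p,q)^* identified with sqrt(-1) u(p,q) through Tr(AB). *)
Definition u_dual (p q : nat) : set 'M[R[i]]_(p + q) :=
  [set A | signature_mx p q *m A \is hermsymmx].
Arguments u_dual : clear implicits.

(* Under this identification the coadjoint action is conjugation. *)
Definition coadjoint_orbit_of (p q : nat) (A : 'M[R[i]]_(p + q)) :
    set 'M[R[i]]_(p + q) :=
  [set g *m A *m invmx g | g in indefinite_unitary p q].

Definition coadjoint_orbit (p q : nat) (O : set 'M[R[i]]_(p + q)) : Prop :=
  exists2 A, A \in u_dual p q & O = coadjoint_orbit_of A.

Definition diag_pair (p q : nat) (lam : p.-tuple R) (mu : q.-tuple R) :
    'M[R[i]]_(p + q) :=
  diag_mx (\row_k (tnth (cat_tuple lam mu) k)%:C).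

(* Entries are indexed from 0: [lam`_0] is the smallest lambda and [mu`_q.-1]
   the largest mu; the comparison is vacuous when one of the blocks is empty. *)
Definition admissible (p q : nat) (lam : p.-tuple R) (mu : q.-tuple R) : Prop :=
  [/\ sorted <=%R lam, sorted <=%R mu &
      (0 < p)%N -> (0 < q)%N -> mu`_q.-1 < lam`_0].

Definition admissible_orbit (p q : nat) (O : set 'M[R[i]]_(p + q)) : Prop :=
  exists (lam : p.-tuple R) (mu : q.-tuple R),
    admissible lam mu /\ O = coadjoint_orbit_of (diag_pair lam mu).

(* [s] lists the eigenvalues, with multiplicity, of every matrix of [O]. *)
Definition orbit_eigenvalues (n : nat) (O : set 'M[R[i]]_n) (s : seq R) : Prop :=
  forall A, A \in O -> char_poly A = \prod_(x <- s) ('X - (x%:C)%:P).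

Lemma leq_add_pred (p q : nat) : (p + q.-1 <= p + q)%N.
Proof. by rewrite leq_add2l leq_pred. Qed.

(* p_n : the upper left principal submatrix of size p + q - 1. *)
Definition u_proj (p q : nat) (A : 'M[R[i]]_(p + q)) : 'M[R[i]]_(p + q.-1) :=
  mxsub (widen_ord (leq_add_pred p q)) (widen_ord (leq_add_pred p q)) A.

End IndefiniteUnitary.

Arguments signature_mx : clear implicits.
Arguments indefinite_unitary : clear implicits.
Arguments u_dual : clear implicits.
Arguments u_proj {R p q} A.

(* Main.v *)
(* If A = g D g^-1 lies in the orbit of D = diag(lam, mu), then the Hermitian
   matrix J(A - t) is congruent to J(D - t), the diagonal matrix with entries
   lam_i - t and t - mu_j, and its upper left principal submatrix is J'(B - t),
   where B is the projection of A and J' the smaller signature matrix.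

   For mu_q < c < lam_1 the form J(A - c) is positive definite, hence so is
   J'(B - c), and diagonalizing J' simultaneously with it shows that B is
   conjugate under U(p, q-1) to an admissible diagonal matrix.

   For arbitrary t, the number of negative diagonal entries of J'(D' - t) and
   the number of nonnegative ones of J(D - t) add up to at most n, and likewise
   with the roles exchanged; taking t among the eigenvalues gives interlacing. *)
Require Import Defs.
From HB Require Import structures.
From mathcomp Require Import all_boot all_order all_algebra.
From mathcomp Require Import sesquilinear spectral.
From mathcomp Require Import boolp classical_sets reals.
From mathcomp Require Import complex.
From mathcomp Require Import perm.
From mathcomp Require Import zify ring lra.

Import Order.TTheory GRing.Theory Num.Theory.

Local Open Scope classical_set_scope.
Local Open Scope sesquilinear_scope.
Local Open Scope ring_scope.

(** * Index intervals, inverses of products, and conjugation invariance of the characteristic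
    polynomial *)

Section Preliminaries.
Set Implicit Arguments.
Unset Strict Implicit.
Unset Printing Implicit Defensive.

Lemma widen_ord_inj m n (le_mn : (m <= n)%N) : injective (widen_ord le_mn).
Proof. by move=> i j [eq_ij]; apply: val_inj. Qed.

Lemma card_ord_interval m a b : (a <= b)%N -> (b <= m)%N ->
  #|[set k : 'I_m | (a <= k < b)%N]%SET| = (b - a)%N.
Proof.
move=> le_ab le_bm; rewrite cardsE -sum1_card -[RHS]muln1 -sum_nat_const_nat.
rewrite big_geq_mkord /=.
by rewrite (big_ord_widen_cond m (fun k => a <= k)%N (fun=> 1%N)).
Qed.

Lemma invmx_mul (R : comUnitRingType) n (A B : 'M[R]_n) : A \in unitmx -> B \in unitmx ->
  invmx (A *m B) = invmx B *m invmx A.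
Proof.
move=> uA uB; apply: (can_inj (mulKmx (_ : A *m B \in unitmx))).
  by rewrite unitmx_mul uA.
by rewrite mulmxV ?unitmx_mul ?uA // mulmxA mulmxK // mulmxV.
Qed.

Lemma char_poly_conj (R : comUnitRingType) n (g A : 'M[R]_n) : g \in unitmx ->
  char_poly (g *m A *m invmx g) = char_poly A.
Proof.
move=> ug; have gV : map_mx polyC g *m map_mx polyC (invmx g) = 1%:M.
  by rewrite -map_mxM mulmxV // map_mx1.
rewrite /char_poly; have -> : char_poly_mx (g *m A *m invmx g) =
    map_mx polyC g *m char_poly_mx A *m map_mx polyC (invmx g).
  rewrite /char_poly_mx mulmxBr mulmxBl scalar_mxC -(mulmxA _%:M) gV mulmx1.
  by rewrite !map_mxM.
by rewrite !det_mulmx mulrAC -det_mulmx gV det1 mul1r.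
Qed.

End Preliminaries.

(** * Hermitian forms over a closed field: inertia inequalities and simultaneous diagonalization *)

Section Inertia.
Set Implicit Arguments.
Unset Strict Implicit.
Unset Printing Implicit Defensive.

Variable C : numClosedFieldType.

Lemma trmxC_mul m n k (A : 'M[C]_(m, n)) (B : 'M[C]_(n, k)) :
  (A *m B)^t* = B^t* *m A^t*.
Proof. by rewrite trmx_mul map_mxM. Qed.

Lemma trmxC_unitmx n (A : 'M[C]_n) : (A^t* \in unitmx) = (A \in unitmx).
Proof. by rewrite map_unitmx unitmx_tr. Qed.

Lemma diag_form n (d v : 'rV[C]_n) :
  (v *m diag_mx d *m v^t*) 0 0 = \sum_i d 0 i * `|v 0 i| ^+ 2.
Proof.
rewrite mul_mx_diag !mxE; apply: eq_bigr => i _.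
by rewrite !mxE normCK mulrAC mulrC mulrA.
Qed.

(** Keeping some of the rows of [G] restricts the form [H] to fewer vectors, so the Gram matrix
    shrinks to the corresponding submatrix. *)
Lemma mul_rowsub_congr m n k (f : 'I_k -> 'I_m) (G : 'M[C]_(m, n)) H :
  rowsub f G *m H *m (rowsub f G)^t* = mxsub f f (G *m H *m G^t*).
Proof.
rewrite mul_rowsub_mx; apply/matrixP => i j; rewrite !mxE.
by apply: eq_bigr => l _; rewrite !mxE.
Qed.

Lemma row_free_rowsub m n k (f : 'I_k -> 'I_m) (G : 'M[C]_(m, n)) :
  injective f -> row_free G -> row_free (rowsub f G).
Proof.
move=> f_inj freeG; have -> : rowsub f G = rowsub f 1%:M *m G.
  by rewrite mul_rowsub_mx mul1mx.
rewrite /row_free mxrankMfree //; apply/row_freeP.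
exists (rowsub f 1%:M)^T; rewrite mul_rowsub_mx mul1mx.
by apply/matrixP => i j; rewrite !mxE (inj_eq f_inj) eq_sym.
Qed.

(* A negative definite and a nonnegative subspace meet trivially. *)
Lemma neg_nneg_leq m1 m2 n (H : 'M[C]_n) (G1 : 'M[C]_(m1, n))
    (G2 : 'M[C]_(m2, n)) (d1 : 'rV[C]_m1) (d2 : 'rV[C]_m2) :
  row_free G2 ->
  G1 *m H *m G1^t* = diag_mx d1 -> G2 *m H *m G2^t* = diag_mx d2 ->
  (forall i, d1 0 i < 0) -> (forall i, 0 <= d2 0 i) -> (m1 + m2 <= n)%N.
Proof.
move=> free2 e1 e2 neg1 nneg2; rewrite leqNgt; apply/negP => lt_n.
(* More than [n] rows are dependent: some nonzero [u = (u1, u2)] satisfies [u1 G1 = - u2 G2]. *)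
have : kermx (col_mx G1 G2) != 0.
  rewrite kermx_eq0 /row_free neq_ltn.
  by rewrite (leq_ltn_trans (rank_leq_col _) lt_n).
case/rowV0Pn => u /sub_kermxP + /negP; rewrite -[u]hsubmxK mul_row_col.
set u1 := lsubmx u; set u2 := rsubmx u => /eqP.
rewrite addr_eq0 => /eqP Eu; apply; apply/eqP.
(* Both sides are the value of [H] at one vector up to sign, hence at once nonpositive and
   nonnegative, so zero. *)
have Ef : (u1 *m diag_mx d1 *m u1^t*) 0 0 = (u2 *m diag_mx d2 *m u2^t*) 0 0.
  rewrite -e1 -e2 !mulmxA -!mulmxA -!trmxC_mul !mulmxA Eu.
  by rewrite !mulNmx linearN map_mxN mulmxN opprK.
have le2 : 0 <= (u2 *m diag_mx d2 *m u2^t*) 0 0.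
  by rewrite diag_form sumr_ge0 // => i _; rewrite mulr_ge0 ?exprn_ge0.
have /eqP u10 : u1 == 0.
  apply/eqP/rowP => i; rewrite [RHS]mxE; apply/eqP.
  have /eqP : - (u1 *m diag_mx d1 *m u1^t*) 0 0 = 0.
    apply/eqP; rewrite eq_le oppr_le0 Ef le2 /= -Ef diag_form -sumrN sumr_ge0 //.
    by move=> j _; rewrite -mulNr mulr_ge0 ?exprn_ge0 // oppr_ge0 ltW.
  rewrite diag_form -sumrN psumr_eq0; last first.
    by move=> j _; rewrite -mulNr mulr_ge0 ?exprn_ge0 // oppr_ge0 ltW.
  move/allP/(_ i (mem_index_enum _)) => /=.
  by rewrite oppr_eq0 mulf_eq0 lt_eqF //= expf_eq0 /= normr_eq0.
have u20 : u2 = 0.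
  apply: (row_free_inj free2); rewrite /= mul0mx; apply/eqP.
  by rewrite -oppr_eq0 -Eu u10 mul0mx.
by rewrite u10 u20 row_mx0.
Qed.

(** The rows of [G1] indexed by [S1] and those of [G2] indexed by [S2] have diagonal Gram matrices
    of the required signs, which reduces the count to [neg_nneg_leq]. *)
Lemma card_neg_nneg_leq m1 m2 n (H : 'M[C]_n) (G1 : 'M[C]_(m1, n))
    (G2 : 'M[C]_(m2, n)) (d1 : 'rV[C]_m1) (d2 : 'rV[C]_m2)
    (S1 : {set 'I_m1}) (S2 : {set 'I_m2}) :
  row_free G2 ->
  G1 *m H *m G1^t* = diag_mx d1 -> G2 *m H *m G2^t* = diag_mx d2 ->
  {in S1, forall i, d1 0 i < 0} -> {in S2, forall i, 0 <= d2 0 i} ->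
  (#|S1| + #|S2| <= n)%N.
Proof.
move=> free2 e1 e2 neg1 nneg2.
have sub_diag m (d : 'rV[C]_m) (S : {set 'I_m}) :
    mxsub (@enum_val _ (mem S)) (@enum_val _ (mem S)) (diag_mx d) =
    diag_mx (\row_(i < #|S|) d 0 (enum_val i)).
  by apply/matrixP => i j; rewrite !mxE (inj_eq enum_val_inj).
apply: (@neg_nneg_leq _ _ _ H (rowsub (@enum_val _ (mem S1)) G1)
   (rowsub (@enum_val _ (mem S2)) G2)).
- exact: row_free_rowsub enum_val_inj _.
- by rewrite mul_rowsub_congr e1 sub_diag.
- by rewrite mul_rowsub_congr e2 sub_diag.
- by move=> i; rewrite mxE neg1 // enum_valP.
- by move=> i; rewrite mxE nneg2 // enum_valP.
Qed.

(** A unitary diagonalization of [P] followed by rescaling makes [P] the identity; a further unitary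
    change of basis then diagonalizes [H] and preserves the identity. *)
Lemma simultaneous_diag n (P H : 'M[C]_n) :
  P^t* = P -> H^t* = H ->
  (forall v : 'rV[C]_n, v != 0 -> 0 < (v *m P *m v^t*) 0 0) ->
  exists F : 'M[C]_n, exists e : 'rV[C]_n,
    [/\ F \in unitmx, F *m P *m F^t* = 1%:M, F *m H *m F^t* = diag_mx e
      & forall i, e 0 i \is Num.real].
Proof.
move=> hP hH posP.
have herm (X : 'M[C]_n) : X^t* = X -> X \is hermsymmx.
  by move=> hX; apply/is_hermitianmxP; rewrite expr0 scale1r hX.
have spec (X : 'M[C]_n) : X^t* = X ->
    exists U : 'M[C]_n, exists d : 'rV[C]_n,
    [/\ U \in unitmx, U *m U^t* = 1%:M & U *m X *m U^t* = diag_mx d].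
  move=> hX; exists (spectralmx X), (spectral_diag X).
  split; [exact: spectral_unit | exact/unitarymxP/spectral_unitarymx |].
  have /hermitian_normalmx/orthomx_spectralP {2}-> := herm _ hX.
  rewrite -invmx_unitary ?spectral_unitarymx //.
  by rewrite !mulmxA mulmxV ?spectral_unit // mul1mx mulmxK ?spectral_unit.
have [U [d [unU UU eU]]] := spec _ hP.
(* The eigenvalue [d 0 i] is the value of [P] at row [i] of [U], which is nonzero because [U] is
   invertible. *)
have dpos i : 0 < d 0 i.
  have -> : d 0 i = (row i U *m P *m (row i U)^t*) 0 0.
    have -> : d 0 i = (U *m P *m U^t*) i i by rewrite eU mxE eqxx mulr1n.
    by rewrite -row_mul !mxE; apply: eq_bigr => k _; rewrite !mxE.
  apply: posP; apply/eqP => rU0.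
  have := row_mul i U (invmx U).
  rewrite rU0 mul0mx mulmxV // => /rowP/(_ i) /eqP.
  by rewrite !mxE eqxx oner_eq0.
pose r : 'rV[C]_n := \row_i (sqrtC (d 0 i))^-1.
have rpos i : 0 < r 0 i by rewrite mxE invr_gt0 sqrtC_gt0.
have rt : (diag_mx r)^t* = diag_mx r.
  rewrite tr_diag_mx map_diag_mx; congr diag_mx; apply/rowP => i.
  by rewrite [LHS]mxE; exact/CrealP/gtr0_real/rpos.
pose T := diag_mx r *m U.
have TP : T *m P *m T^t* = 1%:M.
  rewrite /T trmxC_mul rt !mulmxA -(mulmxA (diag_mx r) U) -(mulmxA _ _ (U^t*)).
  rewrite eU mul_diag_mx mul_mx_diag; apply/matrixP => i j; rewrite !mxE.
  case: eqVneq => [->|_]; last by rewrite mulr0n mulr0 mul0r.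
  rewrite !mulr1n -{2}(sqrtCK (d 0 j)) expr2.
  have s0 : sqrtC (d 0 j) != 0 by rewrite sqrtC_eq0 gt_eqF.
  by field.
have unT : T \in unitmx.
  rewrite unitmx_mul unU andbT unitmxE det_diag unitfE; apply/prodf_neq0.
  by move=> i _; rewrite gt_eqF.
clearbody T.
have hK : (T *m H *m T^t*)^t* = T *m H *m T^t*.
  by rewrite !trmxC_mul trmxCK hH mulmxA.
have [W [e [unW WW eW]]] := spec _ hK.
exists (W *m T), e; split.
- by rewrite unitmx_mul unW unT.
- by rewrite trmxC_mul !mulmxA -(mulmxA W) -(mulmxA W) TP mulmx1 WW.
- by rewrite trmxC_mul -eW !mulmxA.
move=> i; apply/CrealP.
have : (diag_mx e)^t* = diag_mx e.
  by rewrite -eW !trmxC_mul !trmxCK hH !mulmxA.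
rewrite tr_diag_mx map_diag_mx => /matrixP/(_ i i).
by rewrite !mxE eqxx !mulr1n.
Qed.

End Inertia.

(** * The signature form, its unitary group, and orbits seen as congruence classes *)

Section SignatureForm.
Set Implicit Arguments.
Unset Strict Implicit.
Unset Printing Implicit Defensive.

Variables (R : realType).
Local Open Scope complex_scope.

Lemma signature_mxE p q :
  signature_mx R p q = diag_mx (\row_k (-1) ^+ (p <= k)%N).
Proof.
congr diag_mx; apply/rowP => k; rewrite !mxE; case: splitP => j -> /=.
  by rewrite mxE leqNgt ltn_ord.
by rewrite mxE leq_addr.
Qed.

Lemma signature_mxC p q : (signature_mx R p q)^t* = signature_mx R p q.
Proof.
rewrite signature_mxE tr_diag_mx map_diag_mx; congr diag_mx; apply/rowP => k.
by rewrite !mxE rmorphXn /= rmorphN1.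
Qed.

Lemma signature_mxK p q : signature_mx R p q *m signature_mx R p q = 1%:M.
Proof.
rewrite signature_mxE mul_diag_mx; apply/matrixP => i j; rewrite !mxE.
case: eqVneq => [->|_]; last by rewrite mulr0.
by rewrite mulr1n -signr_addb addbb.
Qed.

Lemma indefinite_unitary_unitmx p q g :
  indefinite_unitary R p q g -> g \in unitmx.
Proof.
rewrite /indefinite_unitary /= => eg.
have /mulmx1_unit[] // : signature_mx R p q *m g^t* *m signature_mx R p q *m g = 1%:M.
by rewrite -!mulmxA (mulmxA (g^t*)) eg signature_mxK.
Qed.

(** This identity turns conjugation of [A] by [g] into congruence of the Hermitian matrix [J A],
    where inertia arguments apply. *)
Lemma indefinite_unitary_adjoint p q g : indefinite_unitary R p q g ->
  g^t* *m signature_mx R p q = signature_mx R p q *m invmx g.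
Proof.
move=> Ug; rewrite -[in RHS]Ug mulmxK //.
exact: indefinite_unitary_unitmx Ug.
Qed.

Lemma indefinite_unitary_mul p q g h : indefinite_unitary R p q g ->
  indefinite_unitary R p q h -> indefinite_unitary R p q (g *m h).
Proof.
rewrite /indefinite_unitary /= => eg eh.
by rewrite trmxC_mul !mulmxA -(mulmxA (h^t*)) -(mulmxA (h^t*)) eg eh.
Qed.

Lemma indefinite_unitary_inv p q g : indefinite_unitary R p q g ->
  indefinite_unitary R p q (invmx g).
Proof.
move=> Ug; have ug := indefinite_unitary_unitmx Ug.
rewrite /indefinite_unitary /= -[X in _ *m X *m _]Ug !mulmxA -trmxC_mul.
rewrite mulmxV // trmx1 map_mx1 mul1mx -mulmxA.
by rewrite mulmxV // mulmx1.
Qed.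

Lemma coadjoint_orbit_of_refl p q (A : 'M[R[i]]_(p + q)) :
  coadjoint_orbit_of A A.
Proof.
exists 1%:M; last by rewrite invmx1 mul1mx mulmx1.
by rewrite /indefinite_unitary /= trmx1 map_mx1 mul1mx mulmx1.
Qed.

Lemma coadjoint_orbit_of_eq p q (A B : 'M[R[i]]_(p + q)) :
  coadjoint_orbit_of A B -> coadjoint_orbit_of B = coadjoint_orbit_of A.
Proof.
case=> g Ug <-; have ug := indefinite_unitary_unitmx Ug.
apply/seteqP; split=> _ [h Uh <-]; have uh := indefinite_unitary_unitmx Uh.
  exists (h *m g); first exact: indefinite_unitary_mul.
  by rewrite invmx_mul // !mulmxA.
exists (h *m invmx g).
  exact/indefinite_unitary_mul/indefinite_unitary_inv.
by rewrite invmx_mul ?unitmx_inv // invmxK !mulmxA !mulmxKV.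
Qed.

(* The k-th diagonal entry of J * (diag_pair lam mu - t). *)
Definition level p q (lam : p.-tuple R) (mu : q.-tuple R) (t : R) (k : nat) : R :=
  (-1) ^+ (p <= k)%N * (nth 0 (lam ++ mu) k - t).

(** For [A = g D g^-1], the congruence by [g^*] sends [J A] to [J D] and fixes [J]; hence a single
    [G] diagonalizes the whole pencil, for all [t] at once. *)
Lemma orbit_congr p q (lam : p.-tuple R) (mu : q.-tuple R) A :
  coadjoint_orbit_of (diag_pair lam mu) A ->
  exists2 G, G \in unitmx &
    forall t, G *m (signature_mx R p q *m A - t%:C *: signature_mx R p q) *m G^t*
      = diag_mx (\row_(k < p + q) (level lam mu t k)%:C).
Proof.
case=> g Ug <-; have ug := indefinite_unitary_unitmx Ug.
exists (g^t*); first by rewrite trmxC_unitmx.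
move=> t; rewrite trmxCK mulmxBr mulmxBl -scalemxAr -scalemxAl Ug.
rewrite !mulmxA indefinite_unitary_adjoint // -!mulmxA.
rewrite mulKmx // mulVmx // mulmx1 signature_mxE.
rewrite /diag_pair mul_diag_mx; apply/matrixP => i j; rewrite !mxE.
case: eqVneq => [->|_]; last by rewrite !mulr0n mulr0 mulr0 subr0.
rewrite !mulr1n (tnth_nth 0) /= rmorphM rmorphB rmorphXn rmorphN1 /=.
by rewrite mulrBr [X in _ - X]mulrC.
Qed.

(** Converse passage from congruence to conjugation: [g^* J B g = J g^-1 B g], and cancelling [J]
    gives [D = g^-1 B g]. *)
Lemma coadjoint_orbit_of_congr p q (B D g : 'M[R[i]]_(p + q)) :
  indefinite_unitary R p q g ->
  g^t* *m (signature_mx R p q *m B) *m g = signature_mx R p q *m D ->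
  coadjoint_orbit_of D B.
Proof.
move=> Ug; have ug := indefinite_unitary_unitmx Ug.
rewrite mulmxA indefinite_unitary_adjoint // => eD.
exists g => //; have -> : D = invmx g *m B *m g.
  by rewrite -[D]mul1mx -(signature_mxK p q) -mulmxA -eD !mulmxA signature_mxK mul1mx.
by rewrite !mulmxA mulmxV // mul1mx mulmxK.
Qed.

(* Diagonalize J with respect to P = JB - cJ > 0: an eigenvalue r of J yields
   the eigenvalue c + 1/r of B, so its sign decides on which side of c that
   eigenvalue lies, and the inertia of J counts p of them above c. *)
Lemma admissible_of_posdef p q (B : 'M[R[i]]_(p + q)) (c : R) :
  (signature_mx R p q *m B)^t* = signature_mx R p q *m B ->
  (forall v : 'rV_(p + q), v != 0 ->
     0 < (v *m (signature_mx R p q *m B - c%:C *: signature_mx R p q) *m v^t*) 0 0) ->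
  exists (lam : p.-tuple R) (mu : q.-tuple R),
   [/\ sorted <=%R lam, sorted <=%R mu, {in lam, forall x, c < x},
       {in mu, forall x, x < c} & coadjoint_orbit_of (diag_pair lam mu) B].
Proof.
set J := signature_mx R p q; set P := _ - _ => hB posP.
have hP : P^t* = P.
  rewrite /P linearB linearZ /= map_mxB map_mxZ hB signature_mxC.
  congr (_ - _ *: _).
  by apply/CrealP/complex_realP; exists c.
have [F [e [uF FP FJ reale]]] := simultaneous_diag hP (signature_mxC p q) posP.
pose r i := complex.Re (e 0 i); have er i : e 0 i = (r i)%:C by rewrite RRe_real.
(* [diag_mx e] is congruent to the invertible matrix [J]. *)
have r0 i : r i != 0.
  have : diag_mx e \in unitmx.
    rewrite -FJ !unitmx_mul trmxC_unitmx uF /= andbT.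
    by have /mulmx1_unit[] := signature_mxK p q.
  rewrite unitmxE det_diag unitfE => /prodf_neq0/(_ i isT).
  by rewrite er -(inj_eq (@complexI _)).
have J1 : 1%:M *m J *m (1%:M)^t* = J by rewrite trmx1 map_mx1 mul1mx mulmx1.
pose Sp := [set i | 0 < r i]%SET; pose Sm := (~: Sp)%SET.
have Sm_lt i : i \in Sm -> r i < 0.
  by rewrite !inE -leNgt le_eqVlt (negPf (r0 i)).
have free1 : row_free (1%:M : 'M[R[i]]_(p + q)).
  by rewrite row_free_unit unitmx1.
(* Law of inertia for [J], diagonalized both by [F] and by the identity: [cm] gives at most [q]
   negative [r i], [cp] at most [p] positive ones. As there are [p + q] in all, both bounds are
   equalities. *)
have cm : (#|Sm| + #|[set k : 'I_(p + q) | (0 <= k < p)%N]%SET| <= p + q)%N.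
  apply: (card_neg_nneg_leq free1 FJ).
  - by rewrite J1; exact: signature_mxE.
  - by move=> i /Sm_lt; rewrite er ltcR.
  - by move=> i; rewrite !inE mxE /= ltnNge => /negPf ->.
have cp : (#|[set k : 'I_(p + q) | (p <= k < p + q)%N]%SET| + #|Sp| <= p + q)%N.
  apply: (@card_neg_nneg_leq _ _ _ _ J 1%:M F _ _ _ _ _ _ FJ).
  - by rewrite row_free_unit.
  - by rewrite J1; exact: signature_mxE.
  - by move=> i; rewrite !inE mxE => /andP[-> _]; rewrite ltrN10.
  - by move=> i; rewrite inE er lecR; apply: ltW.
rewrite !card_ord_interval ?leq_addr // in cm cp.
have cS := cardsC Sp; rewrite card_ord -/Sm in cS.
pose f i := c + (r i)^-1.
have szl : size (sort <=%R [seq f i | i <- enum Sp]) == p.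
  by rewrite size_sort size_map -cardE; apply/eqP; lia.
have szm : size (sort <=%R [seq f i | i <- enum Sm]) == q.
  by rewrite size_sort size_map -cardE; apply/eqP; lia.
pose lam : p.-tuple R := Tuple szl; pose mu : q.-tuple R := Tuple szm.
have lam_c : {in lam, forall x, c < x}.
  move=> x; rewrite mem_sort => /mapP[i + ->].
  by rewrite mem_enum inE ltrDl invr_gt0.
have mu_c : {in mu, forall x, x < c}.
  move=> x; rewrite mem_sort => /mapP[i + ->].
  by rewrite mem_enum => /Sm_lt; rewrite /= gtrDl invr_lt0.
(* [s] sends a position in the sorted list [lam ++ mu] to the index of the matching vector of the
   diagonalizing basis. *)
have /tuple_permP[s es] : perm_eq (cat_tuple lam mu) [tuple f i | i < p + q].
  rewrite /= (perm_catl _ (permEl (perm_sort _ _))).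
  rewrite (perm_catr _ (permEl (perm_sort _ _))) -map_cat.
  apply: perm_map; apply: uniq_perm; last 1 first.
  - by move=> i; rewrite mem_cat !mem_enum [in RHS]inE finset.in_setC orbN.
  - rewrite cat_uniq !enum_uniq /= andbT; apply/hasPn => i.
    by rewrite !mem_enum finset.in_setC.
  - exact: enum_uniq.
have lam_sorted : sorted <=%R lam by apply/sort_sorted/le_total.
have mu_sorted : sorted <=%R mu by apply/sort_sorted/le_total.
clearbody lam mu.
have fs (i : 'I_(p + q)) : tnth (cat_tuple lam mu) i = f (s i).
  by rewrite (val_inj es) !tnth_mktuple.
(* The side of [c] on which [f (s i)] lies gives the sign of [r (s i)], which is therefore the
   [i]-th diagonal sign of [J]. *)
have rs (i : 'I_(p + q)) : r (s i) = (-1) ^+ (p <= i)%N * `|r (s i)|.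
  case: leqP => pi; rewrite /= ?expr0 ?expr1 ?mul1r ?mulN1r.
    rewrite ltr0_norm ?opprK // -invr_lt0 -(gtrDl c) -/(f _) -fs (tnth_nth 0) /=.
    rewrite nth_cat size_tuple ifN -?leqNgt //; apply: mu_c.
    by rewrite mem_nth // size_tuple; have := ltn_ord i; lia.
  rewrite gtr0_norm // -invr_gt0 -(ltrDl c) -/(f _) -fs (tnth_nth 0) /=.
  rewrite nth_cat size_tuple pi; apply: lam_c.
  by rewrite mem_nth // size_tuple.
exists lam, mu; split => //.
(* Rescaling by the inverse square roots of the [|r i|] leaves only the signs of [J] in the basis
   [F]; reordering by [s] then restores [J] itself, so [G^t*] is indefinite unitary. *)
pose w : 'rV[R[i]]_(p + q) := \row_i (Num.sqrt `|r i|)^-1%:C.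
have hw : (diag_mx w)^t* = diag_mx w.
  rewrite tr_diag_mx map_diag_mx; congr diag_mx; apply/rowP => i.
  by rewrite !mxE; apply/CrealP/complex_realP; exists (Num.sqrt `|r i|)^-1.
pose G := rowsub s (diag_mx w *m F).
have GX X d : F *m X *m F^t* = diag_mx d ->
    G *m X *m G^t* = diag_mx (\row_i (d 0 (s i) / `|r (s i)|%:C)).
  move=> eX; rewrite mul_rowsub_congr trmxC_mul hw !mulmxA.
  rewrite -(mulmxA (diag_mx w) F) -(mulmxA _ _ (F^t*)) eX.
  rewrite mul_diag_mx mul_mx_diag; apply/matrixP => i j; rewrite !mxE.
  rewrite (inj_eq perm_inj); case: eqVneq => [->|_]; last by rewrite !mulr0n mulr0 mul0r.
  rewrite !mulr1n mulrAC mulrC -rmorphM /= -invfM -expr2 sqr_sqrtr //.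
  by rewrite fmorphV.
have GJ : G *m J *m G^t* = J.
  rewrite (GX _ _ FJ) /J signature_mxE; congr diag_mx; apply/rowP => i.
  rewrite !mxE er [r (s i)]rs rmorphM /= normrM normrX normrN1 expr1n mul1r normr_id.
  rewrite mulfK ?rmorphXn ?rmorphN1 //.
  by rewrite fmorph_eq0 normr_eq0.
apply: (@coadjoint_orbit_of_congr _ _ _ _ (G^t*)).
  by rewrite /indefinite_unitary /= trmxCK.
(* The congruence by [G] sends [J B = P + c J] to the diagonal matrix with entries [1/|r|] plus [c]
   times the sign; this is the sign times [c + 1/r], an entry of [J D]. *)
rewrite trmxCK -/J; have -> : J *m B = P + c%:C *: J by rewrite /P subrK.
rewrite mulmxDr mulmxDl -scalemxAr -scalemxAl GJ.
have -> : G *m P *m G^t* = diag_mx (\row_i (`|r (s i)|%:C)^-1).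
  rewrite (GX P (const_mx 1)) ?diag_const_mx //.
  by congr diag_mx; apply/rowP => i; rewrite !mxE mul1r.
rewrite /J signature_mxE /diag_pair mul_diag_mx.
apply/matrixP => i j; rewrite !mxE fs.
case: eqVneq => [->|_]; last by rewrite !mulr0n !mulr0 addr0.
rewrite !mulr1n /f rmorphD /= mulrDr addrC [c%:C * _]mulrC; congr (_ + _).
have -> : (r (s j))^-1 = (-1) ^+ (p <= j)%N * `|r (s j)|^-1.
  by rewrite {1}rs invfM invr_sign.
rewrite rmorphM /= rmorphXn /= rmorphN1 mulrA -signr_addb addbb mul1r.
by rewrite fmorphV.
Qed.

End SignatureForm.

(** * The projection as compression of Hermitian forms, and the resulting interlacing *)

Section Projection.
Set Implicit Arguments.
Unset Strict Implicit.
Unset Printing Implicit Defensive.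

Variables (R : realType).
Local Open Scope complex_scope.

Lemma row_free_u_proj p q :
  row_free (rowsub (widen_ord (leq_add_pred p q)) 1%:M : 'M[R[i]]_(_, p + q)).
Proof.
by apply: row_free_rowsub; [apply: widen_ord_inj | rewrite row_free_unit unitmx1].
Qed.

Lemma u_proj_congr p q (X : 'M[R[i]]_(p + q)) :
  rowsub (widen_ord (leq_add_pred p q)) 1%:M *m X
    *m (rowsub (widen_ord (leq_add_pred p q)) 1%:M)^t* = u_proj X.
Proof. by rewrite mul_rowsub_congr trmx1 map_mx1 mul1mx mulmx1. Qed.

(** Since [J] is diagonal, multiplying by it commutes with truncation, and truncating [J] removes a
    sign from its second block. *)
Lemma u_proj_pencil p q (A : 'M[R[i]]_(p + q)) (t : R) :
  u_proj (signature_mx R p q *m A - t%:C *: signature_mx R p q) =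
  signature_mx R p q.-1 *m u_proj A - t%:C *: signature_mx R p q.-1.
Proof.
rewrite !signature_mxE !mul_diag_mx; apply/matrixP => i j.
by rewrite !mxE (inj_eq (@widen_ord_inj _ _ _)).
Qed.

Section Compression.
Variables (p q : nat) (lam : p.-tuple R) (mu : q.-tuple R).
Variables (A : 'M[R[i]]_(p + q)).
Hypothesis orbA : coadjoint_orbit_of (diag_pair lam mu) A.

(** The projected pencil is the restriction of the large one to a coordinate subspace, and the large
    one is congruent to a positive diagonal matrix. *)
Lemma u_proj_pencil_gt0 (c : R) : (forall i : 'I_(p + q), 0 < level lam mu c i) ->
  forall v : 'rV_(p + q.-1), v != 0 ->
  0 < (v *m (signature_mx R p q.-1 *m u_proj A - c%:C *: signature_mx R p q.-1)
         *m v^t*) 0 0.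
Proof.
move=> pos v v0; have [G uG eG] := orbit_congr orbA.
rewrite -u_proj_pencil -u_proj_congr !mulmxA -(mulmxA _ _ (v^t*)) -trmxC_mul.
set u := v *m _; have u0 : u != 0.
  rewrite -(mul0mx _ (rowsub (widen_ord (leq_add_pred p q)) 1%:M)).
  by rewrite (inj_eq (row_free_inj (row_free_u_proj p q))).
(* In the coordinates [w = u G^-1] the form is diagonal, and one nonzero coordinate of [w] already
   makes the sum positive. *)
have -> : u = u *m invmx G *m G by rewrite mulmxKV.
have : u *m invmx G != 0.
  by rewrite -(mul0mx _ (invmx G)) (inj_eq (can_inj (mulmxKV uG))).
move: (u *m invmx G) => {u0}w w0.
rewrite trmxC_mul mulmxA -(mulmxA w) -(mulmxA w) eG diag_form.
have [i wi] : exists i, w 0 i != 0.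
  apply/existsP; apply: contraR w0 => /existsPn w0; apply/eqP/rowP => i.
  by rewrite [RHS]mxE; apply/eqP; have := w0 i; rewrite negbK.
have posC j : 0 < (\row_(k < p + q) (level lam mu c k)%:C) 0 j.
  by rewrite mxE (ltcR 0).
rewrite (bigD1 i) //= ltr_pwDl //.
  by rewrite mulr_gt0 ?exprn_gt0 ?normr_gt0.
by rewrite sumr_ge0 // => j _; rewrite mulr_ge0 ?exprn_ge0 // ltW.
Qed.

Variables (lam' : p.-tuple R) (mu' : (q.-1).-tuple R).
Hypothesis orbB : coadjoint_orbit_of (diag_pair lam' mu') (u_proj A).

(** Composing the small diagonalizing matrix with the coordinate inclusion presents both diagonal
    forms as Gram matrices of one form on the large space, so that their signs can be compared. *)
Lemma u_proj_level t : exists G G',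
  [/\ row_free G, row_free G',
      G *m (signature_mx R p q *m A - t%:C *: signature_mx R p q) *m G^t*
        = diag_mx (\row_(k < p + q) (level lam mu t k)%:C) &
      G' *m (signature_mx R p q *m A - t%:C *: signature_mx R p q) *m G'^t*
        = diag_mx (\row_(k < p + q.-1) (level lam' mu' t k)%:C)].
Proof.
have [G uG eG] := orbit_congr orbA.
have [G' uG' eG'] := orbit_congr orbB.
exists G, (G' *m rowsub (widen_ord (leq_add_pred p q)) 1%:M); split => //.
- by rewrite row_free_unit.
- by rewrite /row_free mxrankMfree ?row_free_u_proj // -/(row_free _) row_free_unit.
- by rewrite -eG' -u_proj_pencil -u_proj_congr trmxC_mul !mulmxA.
Qed.

(** Sorted eigenvalues make the indices of a given sign fill intervals, so the inertia inequality is
    stated with interval lengths. *)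
Lemma level_neg_proj t a b c d : (a <= b <= p + q.-1)%N -> (c <= d <= p + q)%N ->
  (forall k, (a <= k < b)%N -> level lam' mu' t k < 0) ->
  (forall k, (c <= k < d)%N -> 0 <= level lam mu t k) ->
  (b - a + (d - c) <= p + q)%N.
Proof.
case/andP=> ab b_le /andP[cd d_le] neg nneg.
have [G [G' [fG _ eG eG']]] := u_proj_level t.
rewrite -(card_ord_interval ab b_le) -(card_ord_interval cd d_le).
apply: (card_neg_nneg_leq fG eG' eG) => k.
  by rewrite inE mxE => /neg; rewrite ltcR.
by rewrite inE mxE => /nneg; rewrite lecR.
Qed.

Lemma level_nneg_proj t a b c d : (a <= b <= p + q)%N -> (c <= d <= p + q.-1)%N ->
  (forall k, (a <= k < b)%N -> level lam mu t k < 0) ->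
  (forall k, (c <= k < d)%N -> 0 <= level lam' mu' t k) ->
  (b - a + (d - c) <= p + q)%N.
Proof.
case/andP=> ab b_le /andP[cd d_le] neg nneg.
have [G [G' [_ fG' eG eG']]] := u_proj_level t.
rewrite -(card_ord_interval ab b_le) -(card_ord_interval cd d_le).
apply: (card_neg_nneg_leq fG' eG eG') => k.
  by rewrite inE mxE => /neg; rewrite ltcR.
by rewrite inE mxE => /nneg; rewrite lecR.
Qed.

Lemma orbit_interlacing : (0 < p)%N -> (0 < q)%N ->
  admissible lam mu -> sorted <=%R (mu' ++ lam') ->
  [/\ forall i, (i < q.-1)%N -> mu`_i <= mu'`_i <= mu`_i.+1,
      forall j, (j < p.-1)%N -> lam`_j <= lam'`_j <= lam`_j.+1
    & lam`_p.-1 <= lam'`_p.-1].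
Proof.
move=> p0 q0 [slam smu /(_ p0 q0) lt_mulam] s'.
have mono (s : seq R) i j : sorted <=%R s -> (i <= j < size s)%N -> s`_i <= s`_j.
  move=> ss /andP[ij js]; apply: (le_sorted_leq_nth 0 ss) => //=.
  by rewrite inE (leq_ltn_trans ij).
have lamM i j : (i <= j < p)%N -> lam`_i <= lam`_j.
  by move=> ij; apply: mono; rewrite ?size_tuple.
have muM i j : (i <= j < q)%N -> mu`_i <= mu`_j.
  by move=> ij; apply: mono; rewrite ?size_tuple.
have [smu' slam'] := cat_sorted2 s'.
have lam'M i j : (i <= j < p)%N -> lam'`_i <= lam'`_j.
  by move=> ij; apply: mono; rewrite ?size_tuple.
have mu'M i j : (i <= j < q.-1)%N -> mu'`_i <= mu'`_j.
  by move=> ij; apply: mono; rewrite ?size_tuple.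
have mulam i j : (i < q)%N -> (j < p)%N -> mu`_i <= lam`_j.
  move=> iq jp; apply: (@le_trans _ _ mu`_q.-1); first by apply: muM; lia.
  by apply: (@le_trans _ _ lam`_0); [exact: ltW | apply: lamM; lia].
have mulam' i j : (i < q.-1)%N -> (j < p)%N -> mu'`_i <= lam'`_j.
  move=> iq jp; have -> : mu'`_i = (mu' ++ lam')`_i by rewrite nth_cat size_tuple iq.
  have -> : lam'`_j = (mu' ++ lam')`_(q.-1 + j).
    by rewrite nth_cat size_tuple ltnNge leq_addr /= addKn.
  by apply: mono; rewrite // size_cat !size_tuple; lia.
have levL t k : (k < p)%N -> level lam mu t k = lam`_k - t.
  by move=> kp; rewrite /level nth_cat size_tuple kp leqNgt kp mul1r.
have levM t k : (p <= k)%N -> level lam mu t k = t - mu`_(k - p).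
  by move=> kp; rewrite /level nth_cat size_tuple kp ltnNge kp mulN1r opprB.
have levL' t k : (k < p)%N -> level lam' mu' t k = lam'`_k - t.
  by move=> kp; rewrite /level nth_cat size_tuple kp leqNgt kp mul1r.
have levM' t k : (p <= k)%N -> level lam' mu' t k = t - mu'`_(k - p).
  by move=> kp; rewrite /level nth_cat size_tuple kp ltnNge kp mulN1r opprB.
(* In each case, if the inequality failed, the chosen [t] would give index
   intervals too long for [level_neg_proj] or [level_nneg_proj]. *)
have lam_le j : (j < p)%N -> lam`_j <= lam'`_j.
  move=> jp; rewrite leNgt; apply/negP => lt_j.
  (* At [t = lam_j] the entries of [lam'] up to index [j] are negative, while those of [lam] from
     [j] on and all those of [mu] are nonnegative: [p + q + 1] in total. *)
  suff : (j.+1 - 0 + (p + q - j) <= p + q)%N by lia.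
  apply: (@level_neg_proj lam`_j); [lia | lia | |] => k kj.
    rewrite levL' ?subr_lt0; last by lia.
    by apply: le_lt_trans lt_j; apply: lam'M; lia.
  have [kp|kp] := ltnP k p.
    by rewrite levL // subr_ge0; apply: lamM; lia.
  by rewrite levM // subr_ge0; apply: mulam; lia.
have le_lam j : (j < p.-1)%N -> lam'`_j <= lam`_j.+1.
  move=> jp; rewrite leNgt; apply/negP => lt_j.
  (* The projected form has one diagonal entry fewer; the extra negative entry at [lam_(j+1)]
     compensates, and the total is again [p + q + 1]. *)
  suff : (j.+2 - 0 + (p + q.-1 - j) <= p + q)%N by lia.
  apply: (@level_nneg_proj lam'`_j); [lia | lia | |] => k kj.
    rewrite levL ?subr_lt0; last by lia.
    by apply: le_lt_trans lt_j; apply: lamM; lia.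
  have [kp|kp] := ltnP k p.
    by rewrite levL' // subr_ge0; apply: lam'M; lia.
  by rewrite levM' // subr_ge0; apply: mulam'; lia.
have mu_le i : (i < q.-1)%N -> mu`_i <= mu'`_i.
  move=> iq; rewrite leNgt; apply/negP => lt_i.
  (* In the [mu] block the entries are [t - mu], so negative entries come from the upper end of
     [mu], while nonnegative ones comprise all of [lam'] and the lower end of [mu']. *)
  suff : (p + q - (p + i) + (p + i.+1 - 0) <= p + q)%N by lia.
  apply: (@level_nneg_proj mu'`_i); [lia | lia | |] => k ki.
    rewrite levM ?subr_lt0; last by lia.
    by apply: lt_le_trans lt_i _; apply: muM; lia.
  have [kp|kp] := ltnP k p.
    by rewrite levL' // subr_ge0; apply: mulam'; lia.
  by rewrite levM' // subr_ge0; apply: mu'M; lia.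
have le_mu i : (i < q.-1)%N -> mu'`_i <= mu`_i.+1.
  move=> iq; rewrite leNgt; apply/negP => lt_i.
  suff : (p + q.-1 - (p + i) + (p + i.+2 - 0) <= p + q)%N by lia.
  apply: (@level_neg_proj mu`_i.+1); [lia | lia | |] => k ki.
    rewrite levM' ?subr_lt0; last by lia.
    by apply: lt_le_trans lt_i _; apply: mu'M; lia.
  have [kp|kp] := ltnP k p.
    by rewrite levL // subr_ge0; apply: mulam; lia.
  by rewrite levM // subr_ge0; apply: muM; lia.
split=> [i iq|j jp|]; first by rewrite mu_le ?le_mu.
  by rewrite lam_le ?le_lam //; lia.
by apply: lam_le; lia.
Qed.

End Compression.

Lemma char_poly_orbit p q (lam : p.-tuple R) (mu : q.-tuple R) A :
  coadjoint_orbit_of (diag_pair lam mu) A ->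
  char_poly A = \prod_(x <- lam ++ mu) ('X - (x%:C)%:P).
Proof.
case=> g /indefinite_unitary_unitmx ug <-; rewrite char_poly_conj //.
rewrite char_poly_trig ?diag_mx_is_trig // (big_tuple _ _ (cat_tuple lam mu)).
by apply: eq_bigr => i _; rewrite !mxE eqxx mulr1n.
Qed.

End Projection.

(** * Admissibility and interlacing for orbits in the projected image *)

Theorem proposition4p1 (R : realType) (p q : nat)
    (q_ge1 : (1 <= q)%N) (le_qp : (q <= p)%N)
    (lam : p.-tuple R) (mu : q.-tuple R) (adm : admissible lam mu)
    (O : set 'M[R[i]]_(p + q.-1)) (orbO : coadjoint_orbit O)
    (subO : O `<=` u_proj @` coadjoint_orbit_of (diag_pair lam mu)) :
  admissible_orbit O /\
  (forall (lam' : p.-tuple R) (mu' : (q.-1).-tuple R),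
     sorted <=%R (mu' ++ lam') ->
     orbit_eigenvalues O (mu' ++ lam') ->
     [/\ forall i, (i < q.-1)%N -> mu`_i <= mu'`_i <= mu`_i.+1,
         forall j, (j < p.-1)%N -> lam`_j <= lam'`_j <= lam`_j.+1
       & lam`_p.-1 <= lam'`_p.-1]).
Proof.
have p_ge1 : (0 < p)%N by exact: leq_trans le_qp.
have [slam smu /(_ p_ge1 q_ge1) lt_mulam] := adm.
case: orbO => B dualB EO.
have OB : O B by rewrite EO; apply: coadjoint_orbit_of_refl.
have [A orbA EB] := subO _ OB.
have hB : (signature_mx R p q.-1 *m B)^t* = signature_mx R p q.-1 *m B.
  have : B \in u_dual R p q.-1 by [].
  by rewrite inE /u_dual /= => /is_hermitianmxP; rewrite expr0 scale1r => <-.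
(* Any value strictly between the largest [mu] and the smallest [lam] would serve; at it, every
   diagonal entry of [J (D - c)] is positive. *)
pose c := (mu`_q.-1 + lam`_0) / 2.
have [lt_c c_lt] : mu`_q.-1 < c /\ c < lam`_0 by rewrite /c; split; lra.
have pos (k : 'I_(p + q)) : 0 < level lam mu c k.
  rewrite /level nth_cat size_tuple; case: ltnP => kp /=.
    rewrite mul1r subr_gt0 (lt_le_trans c_lt) //.
    by apply: (le_sorted_leq_nth 0 slam); rewrite ?inE ?size_tuple.
  rewrite mulN1r opprB subr_gt0; apply: le_lt_trans lt_c.
  by apply: (le_sorted_leq_nth 0 smu); rewrite ?inE ?size_tuple; have := ltn_ord k; lia.
have [] := admissible_of_posdef (c := c) hB.
  by move=> v v0; rewrite -EB; exact: (u_proj_pencil_gt0 orbA pos v0).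
move=> lam1 [mu1 [slam1 smu1 lam1_c mu1_c orbB]].
have lt1 i j : (i < q.-1)%N -> (j < p)%N -> mu1`_i < lam1`_j.
  move=> iq jp; apply: (@lt_trans _ _ c).
    by apply: mu1_c; rewrite mem_nth ?size_tuple.
  by apply: lam1_c; rewrite mem_nth ?size_tuple.
split.
  exists lam1, mu1; split; last by rewrite EO (coadjoint_orbit_of_eq orbB).
  by split=> // _ q1; apply: lt1; rewrite ?prednK.
move=> lam' mu' s' eigO.
(* Both lists are the roots of the characteristic polynomial of [B]. Being sorted as well, they
   coincide, and cutting after [q - 1] entries identifies [mu'] with [mu1] and [lam'] with
   [lam1]. *)
have perm1 : perm_eq (mu' ++ lam') (mu1 ++ lam1).
  apply/(perm_map_inj (@complexI R))/prod_XsubC_eq; rewrite !big_map.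
  have /eigO <- : B \in O by rewrite inE.
  by rewrite (char_poly_orbit orbB) (perm_big _ (permEl (perm_catC _ _))).
have s1 : sorted <=%R (mu1 ++ lam1).
  move: slam1 smu1; rewrite !(sorted_pairwise le_trans) pairwise_cat => -> ->.
  rewrite !andbT; apply/allrelP => x y xmu ylam.
  by apply/ltW/(lt_trans (mu1_c _ xmu))/lam1_c.
have /eqP := le_sorted_eq s' s1 perm1.
rewrite eqseq_cat ?size_tuple // => /andP[/eqP/val_inj e1 /eqP/val_inj e2].
rewrite -EB in orbB; subst mu1 lam1.
exact: (orbit_interlacing orbA orbB p_ge1 q_ge1 adm s').
Qed.
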